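(* Let $k_1<0<k_2$ and $k$ be integers with $k_1<2k<k_2$. Then $$\tilde{E}_{k,k_{1},k_{2}}(t)=\frac{1}{k_{2}-k_{1}}\sum_{j=1}^{k_{2}-k_{1}-1}\left(e^{-\frac{2\pi ijk}{k_{2}-k_{1}}}-e^{\frac{2\pi ij(k-k_{1})}{k_{2}-k_{1}}}\right)\tilde{E}\left(t,e^{\frac{2\pi ij}{k_{2}-k_{1}}}\right).$$
   Context: Let $\omega=e^{2\pi i/3}$. The vertex-centred Kreweras lattice has vertex set $\mathbb{Z}[\omega]\subset\mathbb{C}$ and allowed steps $v\to v-1$, $v\to v-\omega$, $v\to v-\omega^2$; walks may not pass through $0$. The winding angle of a walk (viewed as a path of straight segments) is the total anticlockwise angle through which the vector from $0$ to a point moving continuously along the walk turns around $0$; the length is the number of steps. Let $w_0=1$. $\tilde E(t,s)=\sum t^n s^m\in\mathbb{Z}[s,s^{-1}][[t]]$, summed over all such walks starting at $w_0$ and ending at one of $1,\omega,\omega^2$, where the walk has length $n$ and winding angle $\frac{2\pi m}{3}$. $\tilde{E}_{k,k_1,k_2}(t)$ is the generating function, counted by length (variable $t$), of those walks that start at $w_0$, end at a vertex adjacent to $0$, do not pass through $0$, have winding angle $\frac{2\pi k}{3}$, and are such that the winding angle from the start to each intermediate point of the walk stays within the open interval $\left(\frac{k_1\pi}{3},\frac{k_2\pi}{3}\right)$. *)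

(* Defs.v *)
From HB Require Import structures.
From mathcomp Require Import all_boot all_order all_algebra.
From mathcomp Require Import all_classical all_reals all_analysis.
From mathcomp Require Import complex.
Import Order.TTheory GRing.Theory Num.Theory.
Import numFieldNormedType.Exports.

Set Implicit Arguments.
Unset Strict Implicit.
Unset Printing Implicit Defensive.

Local Open Scope classical_set_scope.
Local Open Scope ring_scope.
Local Open Scope complex_scope.

(* e^{i x} *)
Definition expi (R : realType) (x : R) : R[i] := cos x +i* sin x.

Definition omega (R : realType) : R[i] := expi (2 * pi / 3).

(* A sequence of n steps, [j : 'I_3] standing for v -> v - omega ^ j. Together
   with the start w_0 = 1 it determines the walk, and all its vertices are in
   Z[omega]. *)
Definition steps (n : nat) := n.-tuple 'I_3.

(* The vertex after k steps; constant for k >= n. *)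
Definition vertex (R : realType) (n : nat) (w : steps n) (k : nat) : R[i] :=
  1 - \sum_(i < n | (i < k)%N) omega R ^+ tnth w i.

Definition avoids0 (R : realType) (n : nat) (w : steps n) : bool :=
  [forall k : 'I_n.+1, vertex R w k != 0].

(* The walk as a path of straight segments: [vertex w k] is reached at time k,
   and the whole walk takes place during [0, n]. *)
Definition path_of (R : realType) (n : nat) (w : steps n) (x : R) : R[i] :=
  let k := Num.truncn x in
  vertex R w k + (x - k%:R)%:C * (vertex R w k.+1 - vertex R w k).

(* A continuous determination of the argument along the walk. *)
Definition arg_lift (R : realType) (n : nat) (w : steps n) (th : R -> R) : Prop :=
  {within `[0, n%:R], continuous th} /\
  forall x : R, 0 <= x <= n%:R -> path_of w x = `|path_of w x| * expi (th x).

(* The anticlockwise angle turned around 0 between times 0 and x. For a walk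
   avoiding 0 a lift exists and is unique up to a constant on [0, n], so that
   the choice made by [xget] is immaterial. *)
Definition winding (R : realType) (n : nat) (w : steps n) (x : R) : R :=
  let th := xget (fun=> 0) [set th : R -> R | arg_lift w th] in
  th x - th 0.

Definition winding_angle (R : realType) (n : nat) (w : steps n) : R :=
  winding w n%:R.

(* Adjacency in the lattice, i.e. being joined by a step in either direction. *)
Definition adjacent (R : realType) (u v : R[i]) : bool :=
  [exists j : 'I_3, (v == u - omega R ^+ j) || (u == v - omega R ^+ j)].

(* The coefficient of t^n s^m in E~(t, s). *)
Definition Etilde_coef (R : realType) (n : nat) (m : int) : nat :=
  #|[pred w : steps n |
      [&& avoids0 R w,
          [exists j : 'I_3, vertex R w n == omega R ^+ j]
        & winding_angle R w == 2 * pi * m%:~R / 3]]|.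

(* A formal power series in t is represented by its sequence of coefficients,
   with the pointwise addition and scaling on functions.

   E~(t, s) at a given s. The coefficient of t^n is a Laurent polynomial in s:
   there are finitely many walks of length n, hence finitely many nonzero terms
   in the (finite-support) sum over all m in Z. *)
Definition Etilde (R : realType) (s : R[i]) : nat -> R[i]^o :=
  fun n => \sum_(m \in [set: int]) (Etilde_coef R n m)%:R * s ^ m.

Definition Etilde_confined (R : realType) (k k1 k2 : int) : nat -> R[i]^o :=
  fun n => #|[pred w : steps n |
      [&& avoids0 R w,
          adjacent 0 (vertex R w n),
          winding_angle R w == 2 * pi * k%:~R / 3
        & `[< forall x : R, 0 <= x <= n%:R ->
                k1%:~R * pi / 3 < winding w x < k2%:~R * pi / 3 >]]]|%:R.

(* Main.v *)
Require Import Defs.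
From HB Require Import structures.
From mathcomp Require Import all_boot all_order all_algebra.
From mathcomp Require Import all_classical all_reals all_analysis.
From mathcomp Require Import complex.
From mathcomp Require Import ring lra zify.
Import Order.TTheory GRing.Theory Num.Theory.
Import numFieldNormedType.Exports.

(** The formula is a reflection principle followed by a discrete Fourier
    transform. Put N = k2 - k1, and consider the walks of length n from 1 that
    avoid 0 and end at a power of omega; such a walk w has winding angle
    2 pi m(w) / 3 for an integer m(w).

    The set of steps is invariant under reflection in the lines through 0 of
    direction c pi / 3, c an integer (mirror_omega). A step turns by less than a
    right angle around 0 and changes the height over such a line by at most one
    unit of sin (pi / 3), so a walk whose winding angle passes c pi / 3 visits
    that angle at a vertex (wind_no_crossing). If w leaves the interval
    (k1 pi / 3, k2 pi / 3), it therefore first does so at a vertex lying on one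
    of its two ends c = k1 or c = k2. Reflecting the rest of the walk in the
    corresponding line is an involution of the walks that are not confined
    (bounceK), and it replaces m by c - m (bounce_spec).

    Give w the weight [m = k mod N] - [m = k1 - k mod N]. The involution negates
    it, because k1 and k2 are congruent modulo N; hence the walks that are not
    confined contribute 0 in total (sum_bouncing). For a confined walk
    k1 < 2m < k2, so that the weight is 1 if m = k and 0 otherwise
    (signed_class_inside). The total weight is thus the number of walks to be
    counted (sum_returning). Writing the two indicators with N-th roots of unity
    (sum_roots_of_unity) gives the right-hand side.

    The winding angle is defined through an arbitrary continuous argument of the
    walk. Such an argument is unique up to a constant (arg_lift_unique) and an
    explicit one adds up the angles, given by arctangents, of the steps made so
    far (winding_angle_lift). It is monotone on every step, so a walk is confined
    as soon as its vertices are (winding_confinedP). *)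

Local Open Scope ring_scope.
Local Open Scope complex_scope.

Local Notation Re := complex.Re.
Local Notation Im := complex.Im.

Set Implicit Arguments.
Unset Strict Implicit.
Unset Printing Implicit Defensive.

(** * Polar coordinates *)

Section Expi.
Context {R : realType}.
Implicit Types (x y : R) (z : R[i]).

Lemma expiD x y : expi (x + y) = expi x * expi y.
Proof.
rewrite /expi cosD sinD; apply/eqP; rewrite eq_complex /= eqxx /=.
by rewrite addrC.
Qed.

Lemma expi0 : expi 0 = 1 :> R[i].
Proof. by rewrite /expi cos0 sin0. Qed.

Lemma expiN x : expi (- x) = conjc (expi x).
Proof. by rewrite /expi cosN sinN. Qed.

Lemma expi_neq0 x : expi x != 0.
Proof.
apply/eqP => h; have := expi0; rewrite -(subrr x) expiD h mul0r => /eqP.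
by rewrite eq_sym oner_eq0.
Qed.

Lemma expi_mulN x : expi (- x) = (expi x)^-1.
Proof.
by apply: (mulIf (expi_neq0 x)); rewrite mulVf ?expi_neq0// -expiD addNr expi0.
Qed.

Lemma norm_expi x : `|expi x| = 1.
Proof. by rewrite /expi normc_def /= cos2Dsin2 sqrtr1. Qed.

Lemma expiX x n : expi x ^+ n = expi (x * n%:R).
Proof.
elim: n => [|n IH]; first by rewrite mulr0 expi0.
by rewrite exprS IH -expiD -[in RHS]natr1 mulrDr mulr1 addrC.
Qed.

Lemma expiXz x (m : int) : expi x ^ m = expi (x * m%:~R).
Proof.
case: m => n; first by rewrite -exprnP expiX.
by rewrite NegzE -exprnN expiX -expi_mulN rmorphN /= mulrN.
Qed.

Lemma expi2pi : expi (2 * pi) = 1 :> R[i].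
Proof. by rewrite /expi mulr_natl cos2pi sin2pi. Qed.

Lemma expi2pi_int (m : int) : expi (2 * pi * m%:~R) = 1 :> R[i].
Proof. by rewrite -expiXz expi2pi exp1rz. Qed.

(** By the half-angle formula cos x = 1 - 2 sin(x / 2)^2. *)
Lemma cos_lt1 x : 0 < x < 2 * pi -> cos x < 1.
Proof.
move=> /andP[x0 x1]; have -> : x = x / 2 + x / 2 by field.
have s0 : 0 < sin (x / 2) by apply: sin_gt0_pi; apply/andP; split; lra.
rewrite cosD -!expr2 cos2sin2.
by have := exprn_gt0 2 s0; lra.
Qed.

(** Subtracting the multiple of 2 pi given by a floor leaves an angle in
    [0, 2 pi) of cosine 1, hence 0. *)
Lemma expi_eq1 x : expi x = 1 -> exists m : int, x = 2 * pi * m%:~R.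
Proof.
have p0 : 0 < 2 * pi :> R by rewrite mulr_gt0// pi_gt0.
move=> ex; set m := Num.floor (x / (2 * pi)); exists m.
have /andP[h0 h1] := floor_itv (x / (2 * pi)).
rewrite -/m in h0 h1.
rewrite ler_pdivlMr// in h0; rewrite ltr_pdivrMr// in h1.
set y := x - 2 * pi * m%:~R.
have : expi y = 1 by rewrite /y expiD ex -mulrN -rmorphN expi2pi_int mulr1.
move=> [cy _]; move: h0; rewrite le_eqVlt => /orP[/eqP <-|h0].
  by rewrite mulrC.
suff : cos y < 1 by rewrite cy ltxx.
by apply: cos_lt1; rewrite /y; rewrite intrD in h1; apply/andP; split; lra.
Qed.

(** The principal argument, for z in the open right half-plane only. *)
Definition right_arg z : R := atan (Im z / Re z).

Lemma right_arg_polar z : 0 < Re z -> z = `|z| * expi (right_arg z).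
Proof.
case: z => a b /= a0; rewrite /right_arg /expi normc_def /=.
set t := b / a; have bE : b = a * t by rewrite /t mulrC divfK ?gt_eqF.
have q0 : 0 < 1 + t ^+ 2 by have := sqr_ge0 t; lra.
have c0 : 0 < Num.sqrt (1 + t ^+ 2) by rewrite sqrtr_gt0.
have -> : Num.sqrt (a ^+ 2 + b ^+ 2) = a * Num.sqrt (1 + t ^+ 2).
  rewrite bE exprMn -{1}[a ^+ 2]mulr1 -mulrDr sqrtrM ?sqr_ge0//.
  by rewrite sqrtr_sqr gtr0_norm.
have ct := cos_atan t.
have -> : sin (atan t) = t * cos (atan t).
  have /= <- := congr1 ( *%R^~ (cos (atan t))) (atanK t).
  by rewrite /tan divfK// ct invr_neq0// gt_eqF.
rewrite ct; apply/eqP; rewrite eq_complex /= !mul0r subr0 addr0.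
have S0 := lt0r_neq0 c0.
by rewrite mulfK// eqxx mulrCA mulfK// mulrC -bE eqxx.
Qed.

Lemma polar_angle_unique z x y : z != 0 ->
  z = `|z| * expi x -> z = `|z| * expi y ->
  exists m : int, x - y = 2 * pi * m%:~R.
Proof.
move=> z0 zx; rewrite {1}zx => /(mulfI _) e; apply: expi_eq1.
by rewrite expiD e ?normr_eq0// -expiD subrr expi0.
Qed.

Lemma right_arg_conj z : right_arg (conjc z) = - right_arg z.
Proof. by case: z => a b; rewrite /right_arg /= mulNr atanN. Qed.

Lemma right_arg1 : right_arg 1 = 0.
Proof. by rewrite /right_arg /= mul0r atan0. Qed.

End Expi.

(** * The lattice and its three directions *)

Section Lattice.
Context {R : realType}.
Implicit Types (v : R[i]) (c : int).

Definition normsq v : R := Re v ^+ 2 + Im v ^+ 2.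

Lemma normsq_eq0 v : (normsq v == 0) = (v == 0).
Proof.
by case: v => a b; rewrite eq_complex /normsq /= paddr_eq0 ?sqr_ge0// !sqrf_eq0.
Qed.

(** The signed distance from v to the line through 0 of direction
    c pi / 3. *)
Definition height c v : R := Im (v * expi (- (c%:~R * pi / 3))).

Lemma heightD c u v : height c (u + v) = height c u + height c v.
Proof. by rewrite /height mulrDl; case: (u * _); case: (v * _). Qed.

Lemma heightN c v : height c (- v) = - height c v.
Proof. by rewrite /height mulNr; case: (v * _). Qed.

Lemma height_polar c (r x : R) :
  height c (r%:C * expi x) = r * sin (x - c%:~R * pi / 3).
Proof. by rewrite /height -mulrA -expiD /expi /= mul0r addr0. Qed.

Lemma sin_pi_third_gt0 : 0 < sin (pi / 3) :> R.
Proof. by have p0 := pi_gt0 R; apply: sin_gt0_pi; apply/andP; split; lra. Qed.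

Lemma sin3 (x : R) : sin (3 * x) = sin x * (3 - 4 * sin x ^+ 2).
Proof.
have -> : 3 * x = x + (x + x) by ring.
rewrite !(sinD, cosD).
transitivity (sin x * (3 * cos x ^+ 2 - sin x ^+ 2)); first by ring.
by rewrite cos2sin2; ring.
Qed.

Lemma sin_pi_third_sq : sin (pi / 3) ^+ 2 = 3 / 4 :> R.
Proof.
have s0 := sin_pi_third_gt0.
have := sin3 (pi / 3); rewrite [3 * _]mulrC divfK ?pnatr_eq0// sinpi => /esym/eqP.
rewrite mulf_eq0 gt_eqF//= subr_eq0 => /eqP; lra.
Qed.

(** Since sin (3 x) = sin x (3 - 4 sin^2 x) vanishes at x = c pi / 3, sin x is
    0 or plus or minus sin (pi / 3). *)
Lemma sin_third_pi c : exists2 z : int,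
  (-1 <= z <= 1)%R & sin (c%:~R * pi / 3) = z%:~R * sin (pi / 3) :> R.
Proof.
have s0 := sin_pi_third_gt0; set s := sin (pi / 3) in s0 *.
have s2 : 3 = 4 * s ^+ 2 by rewrite sin_pi_third_sq; field.
have : sin (3 * (c%:~R * pi / 3)) = 0 :> R.
  rewrite [3 * _]mulrC divfK//.
  have : expi (- (c%:~R * pi)) = expi (c%:~R * pi) :> R[i].
    rewrite -[RHS]mulr1 -(expi2pi_int (- c)) -expiD; congr expi.
    by rewrite rmorphN /=; ring.
  by move=> [] + ; rewrite cosN sinN => ?; lra.
rewrite sin3; set y := sin _; rewrite s2 -mulrBr => /eqP.
rewrite !mulf_eq0 pnatr_eq0 /= subr_eq0 eqf_sqr => /or3P[]/eqP.
- by move=> ->; exists 0; rewrite ?mul0r.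
- by move=> ->; exists 1; rewrite ?mul1r.
- by move=> sy; exists (-1); rewrite // mulN1r sy opprK.
Qed.

Lemma omegaX (j : nat) : omega R ^+ j = expi (2 * pi * j%:R / 3).
Proof. by rewrite expiX; congr expi; field. Qed.

(** Seen from any of the lines of direction c pi / 3, a step moves by -1, 0 or
    1 times sin (pi / 3). So a walk cannot jump over such a line without
    visiting it at a vertex. *)
Lemma height_omega c (j : nat) : exists2 z : int,
  (-1 <= z <= 1)%R & height c (omega R ^+ j) = z%:~R * sin (pi / 3).
Proof.
have [z zb zE] := sin_third_pi (2 * j%:Z - c); exists z => //.
rewrite -zE omegaX -[expi _]mul1r -[1]/(1%:C) height_polar mul1r; congr sin.
by rewrite !(rmorphB, rmorphM) /= ; field.
Qed.

(** The value cos (pi / 3) = 1 / 2 comes from sin (pi / 3)^2 = 3 / 4. *)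
Lemma omegaE : omega R = (- 2^-1) +i* sin (pi / 3).
Proof.
have s0 := sin_pi_third_gt0.
have -> : omega R = expi (pi / 3 + pi / 3).
  by rewrite /omega; congr expi; field.
have p0 := pi_gt0 R.
have c0 : 0 < cos (pi / 3) :> R by apply: cos_gt0_pihalf; apply/andP; split; lra.
have c2 : cos (pi / 3) = 2^-1 :> R.
  have := cos2sin2 (pi / 3 : R).
  rewrite sin_pi_third_sq => cc.
  have : (cos (pi / 3) - 2^-1) * (cos (pi / 3) + 2^-1) = 0 :> R.
    by rewrite -subr_sqr cc; field.
  move=> /eqP; rewrite mulf_eq0 [X in _ || X]gt_eqF ?orbF ?subr_eq0; last lra.
  by move/eqP.
by rewrite /expi cosD sinD c2 -!expr2 sin_pi_third_sq; congr (_ +i* _); lra.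
Qed.

Definition eisenstein v := exists a b : int, v = a%:~R + b%:~R * omega R.

Lemma eisenstein1 : eisenstein 1.
Proof. by exists 1, 0; rewrite mul0r addr0. Qed.

Lemma eisensteinB u v : eisenstein u -> eisenstein v -> eisenstein (u - v).
Proof.
move=> [a [b ->]] [c [d ->]]; exists (a - c), (b - d).
by rewrite !rmorphB /=; ring.
Qed.

Lemma eisenstein_omega (j : 'I_3) : eisenstein (omega R ^+ j).
Proof.
case: j => [[|[|[|//]]] _] /=.
- exact: eisenstein1.
- by exists 0, 1; rewrite mul1r add0r.
- exists (-1), (-1); rewrite omegaE expr2; apply/eqP; rewrite eq_complex /=.
  have := sin_pi_third_sq; rewrite !expr2 => s2.
  by apply/andP; split; apply/eqP; lra.
Qed.

(** The norm form a^2 - a b + b^2 takes integer values. *)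
Lemma normsq_ge1 v : eisenstein v -> v != 0 -> 1 <= normsq v.
Proof.
move=> [a [b ->]]; rewrite -normsq_eq0 omegaE.
have -> : normsq (a%:~R + b%:~R * ((-2^-1) +i* sin (pi / 3))) =
    (a * a - a * b + b * b)%:~R :> R.
  have i2 (m : int) : m%:~R = (m%:~R)%:C :> R[i] by rewrite rmorph_int.
  rewrite !i2 /normsq /=.
  have := sin_pi_third_sq; rewrite !expr2 !(rmorphB, rmorphD, rmorphM) /= => s2.
  set x := a%:~R; set y := b%:~R; set s := sin _ in s2 *.
  transitivity (x * x - x * y + y * y / 4 + y * y * (s * s)); first by field.
  by rewrite s2; field.
rewrite intr_eq0 -[1]/(1%:~R) ler_int => n0.
have : (0 <= a * a - a * b + b * b)%R by nia.
lia.
Qed.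

Lemma normsq_omega (j : nat) : normsq (omega R ^+ j) = 1.
Proof. by rewrite omegaX /normsq /expi /= cos2Dsin2. Qed.

(** A step turns by less than a right angle around 0. Writing u for the next
    vertex, the real part of u times the conjugate of v is
    (|u|^2 + |v|^2 - 1) / 2, and u and v have norm at least 1. *)
Lemma step_ratio_Re_gt0 v (j : 'I_3) : eisenstein v -> v != 0 ->
  v - omega R ^+ j != 0 -> 0 < Re ((v - omega R ^+ j) / v).
Proof.
move=> lv v0 u0; have hv := normsq_ge1 lv v0.
have hu := normsq_ge1 (eisensteinB lv (eisenstein_omega j)) u0.
have ho := normsq_omega j; move: hv hu ho.
case: (omega R ^+ j) => p q; case: v {lv v0 u0} => x y.
rewrite /normsq /= => hv hu ho.
set d := x ^+ 2 + y ^+ 2 in hv *.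
have -> : (x - p) * (x / d) - (y - q) * (- (y / d)) = (d - (p * x + q * y)) / d.
  by rewrite /d; field; rewrite -/d; lra.
rewrite divr_gt0//; last lra.
have : (x - p) ^+ 2 + (y - q) ^+ 2 = d - 2 * (p * x + q * y) + (p ^+ 2 + q ^+ 2).
  by rewrite /d; ring.
lra.
Qed.

End Lattice.

(** * An explicit formula for the winding angle *)

Section Winding.
Context {R : realType}.
Implicit Types (x s : R) (z r : R[i]).

(** The point at time s of the segment from 1 to r. After division by its
    starting vertex, every step of a walk has this form. *)
Definition segment r s : R[i] := 1 + s%:C * (r - 1).

Lemma segmentE r s : segment r s = (1 + s * (Re r - 1)) +i* (s * Im r).
Proof.
case: r => a b; rewrite /segment; apply/eqP; rewrite eq_complex /=.
by apply/andP; split; apply/eqP; ring.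
Qed.

Lemma segment0 r : segment r 0 = 1.
Proof. by rewrite /segment mul0r addr0. Qed.

Lemma segment1 r : segment r 1 = r.
Proof. by rewrite /segment mul1r addrC subrK. Qed.

Lemma segment_Re_gt0 r s : 0 <= s <= 1 -> 0 < Re r -> 0 < Re (segment r s).
Proof.
move=> /andP[s0 s1] r0; rewrite segmentE /=.
have : 0 <= s * Re r by rewrite mulr_ge0// ltW.
have [->|] := eqVneq s 0; first by rewrite !mul0r; lra.
move=> sn0; have : 0 < s * Re r by rewrite mulr_gt0// lt0r sn0.
lra.
Qed.

Lemma right_arg_segment r s :
  right_arg (segment r s) = atan (s * Im r / (1 + s * (Re r - 1))).
Proof. by rewrite segmentE. Qed.

(** The angle is monotone along a segment, because its tangent is a
    homographic function of s. This reduces confinement at all real times to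
    confinement at the vertices. *)
Lemma right_arg_segment_between r s : 0 <= s <= 1 -> 0 < Re r ->
  0 <= right_arg (segment r s) <= right_arg r \/
  right_arg r <= right_arg (segment r s) <= 0.
Proof.
move=> s01 r0; have d0 := segment_Re_gt0 s01 r0; move: s01 => /andP[s0 s1].
rewrite right_arg_segment /right_arg.
rewrite segmentE /= in d0; set d := 1 + _ in d0 *.
have [i0|i0] := leP 0 (Im r); [left|right]; apply/andP; split.
- by rewrite -(atan0 R) le_atan// divr_ge0 ?mulr_ge0// ltW.
- apply: le_atan; rewrite ler_pdivrMr// mulrAC ler_pdivlMr// /d.
  have : 0 <= Im r * (1 - s) by rewrite mulr_ge0// subr_ge0.
  lra.
- apply: le_atan; rewrite ler_pdivrMr// mulrAC ler_pdivlMr// /d.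
  have : 0 <= - Im r * (1 - s) by rewrite mulr_ge0 ?subr_ge0// oppr_ge0 ltW.
  lra.
- by rewrite -(atan0 R) le_atan// ler_pdivrMr// mul0r mulr_ge0_le0// ltW.
Qed.

(** The projection of x onto [0, 1], written with absolute values so that its
    continuity is immediate. *)
Definition clamp x : R := (`|x| - `|x - 1| + 1) / 2.

Lemma clamp_le0 x : x <= 0 -> clamp x = 0.
Proof.
move=> x0; rewrite /clamp ler0_norm// ler0_norm; last lra.
by field.
Qed.

Lemma clamp_ge1 x : 1 <= x -> clamp x = 1.
Proof.
move=> x1; rewrite /clamp ger0_norm ?ger0_norm; [|lra..].
by field.
Qed.

Lemma clamp_id x : 0 <= x <= 1 -> clamp x = x.
Proof.
move=> /andP[x0 x1]; rewrite /clamp ger0_norm ?ler0_norm; [|lra..].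
by field.
Qed.

Lemma clamp01 x : 0 <= clamp x <= 1.
Proof.
have [x0|x0] := leP x 0; first by rewrite clamp_le0// lexx ler01.
have [x1|x1] := leP x 1; first by rewrite clamp_id ?x1 ?ltW.
by rewrite clamp_ge1 ?lexx ?ler01// ltW.
Qed.

Lemma continuous_right_arg_clamp r (a : R) : 0 < Re r ->
  continuous (fun x => right_arg (segment r (clamp (x - a)))).
Proof.
move=> r0.
have dist (b x : R) : (`|y - b| @[y --> x] --> `|x - b|)%classic.
  by apply: cvg_norm; apply: cvgB; [exact: cvg_id|exact: cvg_cst].
have cc (x : R) : (clamp (y - a) @[y --> x] --> clamp (x - a))%classic.
  rewrite /clamp; apply: cvgM; last exact: cvg_cst.
  apply: cvgD; last exact: cvg_cst.
  apply: cvgB; first exact: dist.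
  by under eq_fun do rewrite -addrA -opprD; rewrite -addrA -opprD; exact: dist.
have -> : (fun x => right_arg (segment r (clamp (x - a)))) =
  (fun x => atan (clamp (x - a) * Im r / (1 + clamp (x - a) * (Re r - 1)))).
  by apply/funext => x; rewrite right_arg_segment.
move=> x; apply: (@continuous_comp _ _ _
  (fun x => clamp (x - a) * Im r / (1 + clamp (x - a) * (Re r - 1))) atan);
  last exact: continuous_atan.
apply: cvgM; first by apply: cvgM; [exact: cc|exact: cvg_cst].
apply: cvgV.
  have := segment_Re_gt0 (clamp01 (x - a)) r0.
  by rewrite segmentE /= => /lt0r_neq0.
by apply: cvgD; [exact: cvg_cst|apply: cvgM; [exact: cc|exact: cvg_cst]].
Qed.

Section OneWalk.
Variables (n : nat) (w : steps n).

Lemma vertex0 : vertex R w 0 = 1.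
Proof. by rewrite /vertex big_pred0 ?subr0. Qed.

Lemma vertexS (i : 'I_n) : vertex R w i.+1 = vertex R w i - omega R ^+ tnth w i.
Proof.
rewrite /vertex (bigD1 i) ?ltnSn//= opprD addrA addrAC; congr (_ - _ - _).
by apply: eq_bigl => j; rewrite ltnS andbC -ltn_neqAle.
Qed.

Lemma vertex_last : vertex R w n.+1 = vertex R w n.
Proof.
rewrite /vertex; congr (_ - _); apply: eq_bigl => j.
by rewrite ltnS ltn_ord ltnW.
Qed.

Lemma eisenstein_vertex k : (k <= n)%N -> eisenstein (vertex R w k).
Proof.
elim: k => [_|k IH kn]; first by rewrite vertex0; exact: eisenstein1.
have -> := vertexS (Ordinal kn).
by apply: eisensteinB; [exact: IH (ltnW kn)|exact: eisenstein_omega].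
Qed.

Definition ratio k : R[i] := vertex R w k.+1 / vertex R w k.

(** The winding angle at vertex k, as the sum of the angles of the steps. *)
Definition wind k : R := \sum_(i < k) right_arg (ratio i).

Lemma wind0 : wind 0 = 0.
Proof. by rewrite /wind big_ord0. Qed.

Lemma windS k : wind k.+1 = wind k + right_arg (ratio k).
Proof. by rewrite /wind big_ord_recr. Qed.

(** Step i contributes nothing before time i, its partial angle during
    [i, i + 1] and its full angle afterwards. As a sum of functions continuous
    on the whole line, this determination of the argument needs no gluing of
    pieces. *)
Definition angle_lift x : R :=
  \sum_(i < n) right_arg (segment (ratio i) (clamp (x - i%:R))).

Hypothesis w0 : avoids0 R w.

Lemma vertex_neq0 k : (k <= n)%N -> vertex R w k != 0.
Proof. by rewrite -ltnS => kn; have /forallP/(_ (Ordinal kn)) := w0. Qed.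

(** The walk is constant after time n; this virtual step of angle 0 lets the
    statements below cover the final time as well. *)
Lemma ratio_last : ratio n = 1.
Proof. by rewrite /ratio vertex_last divff// vertex_neq0. Qed.

Lemma walk_ratio_Re_gt0 k : (k <= n)%N -> 0 < Re (ratio k).
Proof.
rewrite leq_eqVlt => /orP[/eqP ->|kn]; first by rewrite ratio_last ltr01.
have := vertex_neq0 kn; have := vertexS (Ordinal kn); rewrite /= /ratio => ->.
apply: step_ratio_Re_gt0; first by apply: eisenstein_vertex; exact: ltnW.
by apply: vertex_neq0; exact: ltnW.
Qed.

Lemma vertex_polar k : (k <= n)%N ->
  vertex R w k = `|vertex R w k| * expi (wind k).
Proof.
elim: k => [_|k IH kn]; first by rewrite vertex0 normr1 wind0 expi0 mulr1.
have kn' := ltnW kn.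
have -> : vertex R w k.+1 = vertex R w k * ratio k.
  by rewrite /ratio mulrC divfK ?vertex_neq0.
rewrite windS expiD normrM mulrACA -(right_arg_polar (walk_ratio_Re_gt0 kn')).
by rewrite -IH.
Qed.

Lemma angle_lift_segment k s : (k <= n)%N -> 0 <= s <= 1 ->
  angle_lift (k%:R + s) = wind k + right_arg (segment (ratio k) s).
Proof.
move=> kn /andP[s0 s1]; rewrite /angle_lift.
pose F i := right_arg (segment (ratio i) (clamp (k%:R + s - i%:R))).
transitivity (\sum_(i < n.+1) F i).
  rewrite big_ord_recr /= /F ratio_last /segment subrr mulr0 addr0 right_arg1.
  rewrite addr0.
  by apply: eq_bigr.
rewrite -(big_mkord xpredT F) (big_cat_nat (n := k.+1)) //= big_nat_recr//=.
rewrite [X in _ + X]big_nat_cond [X in _ + X]big1 ?addr0; last first.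
  move=> i; rewrite andbT => /andP[ki _].
  rewrite /F clamp_le0 ?segment0 ?right_arg1//.
  have : (k.+1%:R <= i%:R :> R) by rewrite ler_nat.
  by rewrite -natr1; lra.
rewrite {2}/F addrAC subrr add0r clamp_id ?s0// /wind big_mkord; congr (_ + _).
apply: eq_bigr => -[i ik] _; rewrite /F /= clamp_ge1 ?segment1//.
have : (i.+1%:R <= k%:R :> R) by rewrite ler_nat.
by rewrite -natr1; lra.
Qed.

Lemma angle_lift_nat k : (k <= n)%N -> angle_lift k%:R = wind k.
Proof.
move=> kn; rewrite -[k%:R]addr0 angle_lift_segment ?lexx ?ler01//.
by rewrite segment0 right_arg1 addr0.
Qed.

Lemma path_of_segment x : let k := Num.truncn x in 0 <= x <= n%:R ->
  [/\ (k <= n)%N, 0 <= x - k%:R <= 1 &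
   path_of w x = vertex R w k * segment (ratio k) (x - k%:R)].
Proof.
move=> k /andP[x0 xn].
have /andP[h0 h1] := truncn_itv x0; rewrite -/k in h0 h1.
have kn : (k <= n)%N by rewrite -(ler_nat R); exact: le_trans xn.
split=> //; first by rewrite -natr1 in h1; lra.
by rewrite /path_of -/k /segment /ratio; field; exact: vertex_neq0.
Qed.

Lemma path_of_neq0 x : 0 <= x <= n%:R -> path_of w x != 0.
Proof.
move=> /path_of_segment [kn s01 ->]; rewrite mulf_neq0 ?vertex_neq0//.
have := segment_Re_gt0 s01 (walk_ratio_Re_gt0 kn).
by apply: contraTneq => ->; rewrite /= ltxx.
Qed.

Lemma continuous_angle_lift : continuous angle_lift.
Proof.
apply: (continuous_big (@add_continuous R)) => i _.
by apply: continuous_right_arg_clamp; apply: walk_ratio_Re_gt0; exact: ltnW.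
Qed.

Lemma arg_lift_angle_lift : arg_lift w angle_lift.
Proof.
split; first exact: continuous_subspaceT continuous_angle_lift.
move=> x xn; have [kn s01 ->] := path_of_segment xn.
set k := Num.truncn x in kn s01 *.
have -> : angle_lift x = wind k + right_arg (segment (ratio k) (x - k%:R)).
  by rewrite -angle_lift_segment//; congr angle_lift; ring.
rewrite normrM expiD mulrACA -vertex_polar// -right_arg_polar//.
by apply: segment_Re_gt0 => //; exact: walk_ratio_Re_gt0.
Qed.

(** The difference d of two lifts takes values in 2 pi Z. If it were not
    constant, the intermediate value theorem would give it a value at distance
    in (0, pi] from another one, outside 2 pi Z. *)
Lemma arg_lift_unique (th1 th2 : R -> R) x : arg_lift w th1 -> arg_lift w th2 ->
  0 <= x <= n%:R -> th1 x - th1 0 = th2 x - th2 0.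
Proof.
move=> [c1 e1] [c2 e2] xn; have /andP[x0 x1] := xn.
pose d y := th1 y - th2 y.
have dE y : 0 <= y <= x -> expi (d y) = 1.
  move=> /andP[y0 y1]; have yn : 0 <= y <= n%:R by rewrite y0 (le_trans y1).
  have [m mE] := polar_angle_unique (path_of_neq0 yn) (e1 _ yn) (e2 _ yn).
  by rewrite /d mE expi2pi_int.
have dc : {within `[0, x], continuous d}%classic.
  apply: (@continuous_subspaceW R R _ `[0, n%:R]%classic).
    move=> y; rewrite !set_itvE /= => /andP[y0 yx].
    by rewrite y0 (le_trans yx).
  by move=> y; apply: continuousB; [exact: c1|exact: c2].
suff : d x = d 0 by rewrite /d; lra.
have ivt v : Num.min (d 0) (d x) <= v <= Num.max (d 0) (d x) -> expi v = 1.
  by move=> /(IVT x0 dc)[c]; rewrite in_itv /= => /dE dc1 <-.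
have p0 := pi_gt0 R.
have gap (a b : R) : a < b -> (forall v, a <= v <= b -> expi v = 1) -> False.
  (* v differs from a by at most pi, so that expi v = expi a is impossible. *)
  move=> ab h; pose v := Num.min b (a + pi).
  have av : a < v by rewrite /v lt_min ab /= ltrDl.
  have vb : v <= b by rewrite /v ge_min lexx.
  have va : v <= a + pi by rewrite /v ge_min lexx orbT.
  have : expi (v - a) = 1.
    have ha : expi a = 1 by apply: h; rewrite lexx ltW.
    have hv : expi v = 1 by apply: h; rewrite vb ltW.
    by rewrite expiD expi_mulN ha hv invr1 mulr1.
  move=> [cv _]; suff : cos (v - a) < 1 by rewrite cv ltxx.
  by apply: cos_lt1; apply/andP; split; lra.
have [lt|gt|//] := ltgtP (d 0) (d x).
- exfalso; apply: (gap _ _ lt) => v vP; apply: ivt.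
  by rewrite (min_idPl (ltW lt)) (max_idPr (ltW lt)).
- exfalso; apply: (gap _ _ gt) => v vP; apply: ivt.
  by rewrite (min_idPr (ltW gt)) (max_idPl (ltW gt)).
Qed.

Lemma winding_angle_lift x : 0 <= x <= n%:R -> winding w x = angle_lift x.
Proof.
move=> xn; rewrite /winding; set th := xget _ _.
have hth : arg_lift w th.
  apply: (@xgetPex _ _ [set th | arg_lift w th]%classic).
  by exists angle_lift; exact: arg_lift_angle_lift.
rewrite (arg_lift_unique hth arg_lift_angle_lift xn).
by have := angle_lift_nat (leq0n n); rewrite wind0 => ->; rewrite subr0.
Qed.

Lemma winding_angleE : winding_angle R w = wind n.
Proof.
by rewrite /winding_angle winding_angle_lift ?lexx ?ler0n// angle_lift_nat.
Qed.

(** Between two vertices the winding angle lies between its values at them. *)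
Lemma winding_confinedP (a b : R) :
  (forall x : R, 0 <= x <= n%:R -> a < winding w x < b) <->
  (forall k, (k <= n)%N -> a < wind k < b).
Proof.
split=> h.
  move=> k kn; have kn' : 0 <= (k%:R : R) <= n%:R by rewrite ler0n ler_nat.
  by rewrite -angle_lift_nat// -winding_angle_lift//; exact: h.
move=> x xn; rewrite winding_angle_lift//; have [kn s01 _] := path_of_segment xn.
set k := Num.truncn x in kn s01 *.
have -> : angle_lift x = wind k + right_arg (segment (ratio k) (x - k%:R)).
  by rewrite -angle_lift_segment//; congr angle_lift; ring.
have /andP[ha hb] := h k kn.
have /andP[ha' hb'] : a < wind k + right_arg (ratio k) < b.
  move: kn; rewrite leq_eqVlt => /orP[/eqP kE|kn]; last by rewrite -windS h.
  by rewrite kE ratio_last right_arg1 addr0 h.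
have := right_arg_segment_between s01 (walk_ratio_Re_gt0 kn).
by move=> [] /andP[u v]; apply/andP; split; lra.
Qed.

End OneWalk.
End Winding.

(** * Reflections of walks *)

Section Reflection.
Context {R : realType}.
Implicit Types (z : R[i]) (c m : int).

Definition rot_third c : R[i] := expi (2 * pi * c%:~R / 3).

Lemma rotD c m : rot_third (c + m) = rot_third c * rot_third m.
Proof. by rewrite /rot_third -expiD; congr expi; rewrite rmorphD /=; field. Qed.

Lemma rot3 m : rot_third (m * 3) = 1.
Proof.
by rewrite -(expi2pi_int m) /rot_third; congr expi; rewrite rmorphM /=; field.
Qed.

Lemma rot_mod c : rot_third (c %% 3)%Z = rot_third c.
Proof. by rewrite [in RHS](divz_eq c 3) [RHS]rotD rot3 mul1r. Qed.

Lemma omega_rot (j : nat) : omega R ^+ j = rot_third j.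
Proof. by rewrite omegaX. Qed.

Lemma conj_rot c : conjc (rot_third c) = rot_third (- c).
Proof. by rewrite /rot_third -expiN; congr expi; rewrite rmorphN /=; field. Qed.

Lemma conjcM z1 z2 : conjc (z1 * z2) = conjc z1 * conjc z2.
Proof. exact: rmorphM. Qed.

Lemma conjcV z : conjc z^-1 = (conjc z)^-1.
Proof. exact: conjc_inv. Qed.

(** The reflection in the line through 0 of direction c pi / 3. *)
Definition mirror c z : R[i] := rot_third c * conjc z.

Lemma mirrorB c z1 z2 : mirror c (z1 - z2) = mirror c z1 - mirror c z2.
Proof. by rewrite /mirror rmorphB mulrBr. Qed.

Lemma mirror_eq0 c z : (mirror c z == 0) = (z == 0).
Proof. by rewrite mulf_eq0 (negbTE (expi_neq0 _)) conjc_eq0. Qed.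

Lemma mirror_ratio c z1 z2 : mirror c z1 / mirror c z2 = conjc (z1 / z2).
Proof.
by rewrite /mirror conjcM conjcV -mulf_div divff ?mul1r// expi_neq0.
Qed.

Lemma mirror_fixed c (r : R) : mirror c (r%:C * expi (c%:~R * pi / 3)) =
  r%:C * expi (c%:~R * pi / 3).
Proof.
rewrite /mirror conjcM conjc_real mulrCA -expiN /rot_third -expiD.
by congr (_ * expi _); field.
Qed.

(** The reflection maps omega ^ j to omega ^ (c - j), so it permutes the three
    steps. *)
Definition mirror_step c (j : 'I_3) : 'I_3 := inord `|((c - j%:Z) %% 3)%Z|%N.

Lemma mirror_stepE c (j : 'I_3) : (mirror_step c j)%:Z = ((c - j%:Z) %% 3)%Z.
Proof.
have h0 : (0 <= (c - j%:Z) %% 3)%Z by exact: modz_ge0.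
have h1 : ((c - j%:Z) %% 3 < 3)%Z by exact: ltz_pmod.
by rewrite /mirror_step inordK; lia.
Qed.

Lemma mirror_stepK c : involutive (mirror_step c).
Proof.
move=> j; apply/val_inj/eqP; rewrite -eqz_nat /= !mirror_stepE.
by have := ltn_ord j; lia.
Qed.

Lemma mirror_omega c (j : 'I_3) :
  omega R ^+ mirror_step c j = mirror c (omega R ^+ j).
Proof.
by rewrite /mirror !omega_rot mirror_stepE rot_mod conj_rot -rotD.
Qed.

Section ReflectWalk.
Variables (n : nat) (T : nat) (c : int).
Implicit Type w : steps n.

Definition reflect_after w : steps n :=
  [tuple if (i < T)%N then tnth w i else mirror_step c (tnth w i) | i < n].

Lemma reflect_afterK : involutive reflect_after.
Proof.
move=> w; apply: eq_from_tnth => i; rewrite !tnth_mktuple.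
by case: (i < T)%N => //=; rewrite mirror_stepK.
Qed.

Lemma vertex_before w k : (k <= T)%N ->
  vertex R (reflect_after w) k = vertex R w k.
Proof.
move=> kT; rewrite /vertex; congr (_ - _); apply: eq_bigr => i ik.
by rewrite tnth_mktuple (leq_trans ik).
Qed.

Lemma wind_before w k : (k <= T)%N ->
  wind (reflect_after w) k = wind w k :> R.
Proof.
move=> kT; rewrite /wind; apply: eq_bigr => i _.
by rewrite /ratio !vertex_before// ?(leq_trans _ kT)// ltnW.
Qed.

Variable w : steps n.
Hypotheses (w0 : avoids0 R w) (Tn : (T <= n)%N).
Hypothesis (wT : wind w T = c%:~R * pi / 3 :> R).

(** At time T the walk is on the mirror, which is where the two halves of the
    new walk are joined. *)
Lemma vertex_after k : (T <= k <= n)%N ->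
  vertex R (reflect_after w) k = mirror c (vertex R w k).
Proof.
elim: k => [|k IH] /andP[Tk kn].
  move: Tk; rewrite leqn0 => /eqP T0; rewrite vertex_before ?T0//.
  by rewrite (vertex_polar w0 (leq0n n)) -T0 wT normc_def mirror_fixed.
move: Tk; rewrite leq_eqVlt => /orP[/eqP TE|Tk].
  rewrite vertex_before ?TE// -TE.
  by rewrite (vertex_polar w0 Tn) wT normc_def mirror_fixed.
have /= -> := @vertexS R n (reflect_after w) (Ordinal kn).
have /= -> := @vertexS R n w (Ordinal kn).
rewrite mirrorB -mirror_omega IH; last by rewrite -ltnS Tk ltnW.
by rewrite tnth_mktuple /= ltnNge -ltnS Tk.
Qed.

(** Reflection conjugates the ratios of consecutive vertices, so it negates the
    angles of all steps after time T. *)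
Lemma wind_after k : (T <= k <= n)%N ->
  wind (reflect_after w) k = 2 * (c%:~R * pi / 3) - wind w k :> R.
Proof.
elim: k => [|k IH] /andP[Tk kn].
  move: Tk; rewrite leqn0 => /eqP T0; rewrite wind_before ?T0//.
  by rewrite -wT T0; ring.
move: Tk; rewrite leq_eqVlt => /orP[/eqP TE|Tk].
  by rewrite wind_before ?TE// -TE wT; ring.
rewrite !windS IH ?(ltnW kn) ?andbT//.
rewrite /ratio !vertex_after ?(ltnW kn) ?andbT ?(ltnW Tk) ?kn//.
rewrite mirror_ratio right_arg_conj; ring.
Qed.

Lemma avoids0_reflect : avoids0 R (reflect_after w).
Proof.
apply/forallP => -[k kn] /=; rewrite ltnS in kn.
have := vertex_neq0 w0 kn; have [Tk|kT] := leqP T k.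
  by rewrite vertex_after ?Tk// mirror_eq0.
by rewrite vertex_before// ltnW.
Qed.

End ReflectWalk.

(** The height over the line of direction c pi / 3 is r sin (wind - c pi / 3)
    with r > 0. As a step turns by less than pi / 2, going from one side of the
    angle c pi / 3 to the other would change the sign of the height; but the
    heights are integers times sin (pi / 3) and change by at most one unit. *)
Lemma wind_no_crossing n (w : steps n) c k : avoids0 R w -> (k < n)%N ->
  ~~ ((wind w k < c%:~R * pi / 3 :> R) && (c%:~R * pi / 3 < wind w k.+1 :> R)) /\
  ~~ ((c%:~R * pi / 3 < wind w k :> R) && (wind w k.+1 < c%:~R * pi / 3 :> R)).
Proof.
move=> w0 kn; have kn' := ltnW kn.
have s0 := @sin_pi_third_gt0 R.
pose H i : R := height c (vertex R w i).
have HE i : (i <= n)%N -> exists2 r : R, 0 < r &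
    H i = r * sin (wind w i - c%:~R * pi / 3).
  move=> i_n.
  exists (Num.sqrt ((Re (vertex R w i)) ^+ 2 + (Im (vertex R w i)) ^+ 2)).
    have := vertex_neq0 w0 i_n.
    by rewrite -normr_gt0 normc_def ltcR.
  by rewrite /H {1}(vertex_polar w0 i_n) normc_def height_polar.
have Hint i : (i <= n)%N -> exists z : int, H i = z%:~R * sin (pi / 3).
  elim: i => [_|i IH i_n].
    have [z _ zE] := @height_omega R c 0; exists z.
    by rewrite /H vertex0 -zE expr0.
  have [y yE] := IH (ltnW i_n).
  have [z _ zE] := @height_omega R c (tnth w (Ordinal i_n)).
  exists (y - z); have vS := vertexS w (Ordinal i_n).
  rewrite /H (vS R) heightD heightN zE.
  by rewrite -/(H i) yE rmorphB /= mulrBl.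
have [d db dE] := @height_omega R c (tnth w (Ordinal kn)).
have Hd : H k.+1 = H k - d%:~R * sin (pi / 3).
  by rewrite /H (vertexS w (Ordinal kn)) heightD heightN dE.
have [y yE] := Hint k kn'; have [z zE] := Hint k.+1 kn.
have yzd : z = y - d.
  have : z%:~R = (y - d)%:~R :> R.
    by apply: (mulIf (lt0r_neq0 s0)); rewrite -zE Hd yE rmorphB /=; ring.
  by move/eqP; rewrite eqr_int => /eqP.
have tpi : `|right_arg (ratio w k)| < pi / 2 :> R.
  by rewrite ltr_norml atan_gtNpi2 atan_ltpi2.
rewrite windS; set t := right_arg _ in tpi *.
move: tpi; rewrite ltr_norml => /andP[t0 t1].
have p0 := pi_gt0 R.
have [r1 r1p h1] := HE k kn'; have [r2 r2p h2] := HE k.+1 kn.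
rewrite windS -/t in h2; set th := wind w k in h1 h2 *.
set a := c%:~R * pi / 3 in h1 h2 *.
have pos u : 0 < u < pi -> 0 < sin u :> R by exact: sin_gt0_pi.
have int_pos (r s : R) (m : int) :
    0 < r -> 0 < s -> r * s = m%:~R * sin (pi / 3) -> (0 < m)%R.
  move=> rp sp e; have : 0 < m%:~R * sin (pi / 3) :> R by rewrite -e mulr_gt0.
  by rewrite pmulr_lgt0// ltr0z.
split; apply/negP => /andP[l1 l2].
  have sz : 0 < sin (th + t - a) by apply: pos; apply/andP; split; lra.
  have sy : 0 < sin (- (th - a)) by apply: pos; apply/andP; split; lra.
  have z0 : (0 < z)%R by apply: (int_pos _ _ z r2p sz); rewrite -h2.
  have y0 : (0 < - y)%R.
    apply: (int_pos _ _ (- y) r1p sy).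
    by rewrite sinN mulrN -h1 yE rmorphN /= mulNr.
  by clear -y0 z0 yzd db; lia.
have sz : 0 < sin (- (th + t - a)) by apply: pos; apply/andP; split; lra.
have sy : 0 < sin (th - a) by apply: pos; apply/andP; split; lra.
have y0 : (0 < y)%R by apply: (int_pos _ _ y r1p sy); rewrite -h1.
have z0 : (0 < - z)%R.
  apply: (int_pos _ _ (- z) r2p sz).
  by rewrite sinN mulrN -h2 zE rmorphN /= mulNr.
by clear -y0 z0 yzd db; lia.
Qed.

End Reflection.

(** * Extracting a residue class with roots of unity *)

Lemma sum_roots_of_unity (R : realType) (N : nat) (a : int) : (0 < N)%N ->
  \sum_(j < N) expi (2 * pi * j%:R * a%:~R / N%:R) =
  ((N %| a)%Z)%:R *+ N :> R[i].
Proof.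
move=> N0; have Nn0 : N%:R != 0 :> R by rewrite pnatr_eq0 -lt0n.
have p0 : 2 * pi != 0 :> R by rewrite mulf_neq0// gt_eqF// pi_gt0.
set z : R[i] := expi (2 * pi * a%:~R / N%:R).
have zX (j : nat) : expi (2 * pi * j%:R * a%:~R / N%:R) = z ^+ j.
  by rewrite expiX; congr expi; field.
under eq_bigr do rewrite zX.
have zN : z ^+ N = 1 by rewrite expiX divfK// expi2pi_int.
have [/dvdzP[q aE]|Na] := boolP (N %| a)%Z.
  have -> : z = 1.
    by rewrite -(expi2pi_int q) /z aE; congr expi; rewrite rmorphM /=; field.
  by under eq_bigr do rewrite expr1n; rewrite sumr_const card_ord.
have : (z - 1) * \sum_(j < N) z ^+ j = 0 by rewrite -subrX1 zN subrr.
rewrite mul0rn => /eqP; rewrite mulf_eq0 => /orP[|/eqP//].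
rewrite subr_eq0 => /eqP /expi_eq1[q qE]; case/negP: Na; apply/dvdzP; exists q.
apply/eqP; rewrite -(eqr_int R) rmorphM /=; apply/eqP.
apply: (mulfI p0); apply: (mulIf (invr_neq0 Nn0)).
by rewrite qE mulrA mulfK.
Qed.

(** * Winding angles of walks ending next to the origin *)

Section Counting.
Context (R : realType) {n : nat}.
Implicit Type w : steps n.

Definition returning w :=
  avoids0 R w && [exists j : 'I_3, vertex R w n == omega R ^+ j].

(** For a returning walk the real number inside is an integer and the floor only
    converts it. *)
Definition thirds w : int := Num.floor (3 * wind w n / (2 * pi) : R).

Lemma thirds_unique w (m : int) :
  wind w n = 2 * pi * m%:~R / 3 :> R -> thirds w = m.
Proof.
move=> e; rewrite /thirds e; have p0 := pi_gt0 R.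
have cancel_pi (p x : R) : p != 0 -> 3 * (2 * p * x / 3) / (2 * p) = x.
  by move=> p_neq0; field.
by rewrite cancel_pi ?intrKfloor ?lt0r_neq0.
Qed.

Lemma wind_thirds w : returning w ->
  wind w n = 2 * pi * (thirds w)%:~R / 3 :> R.
Proof.
move=> /andP[w0 /existsP[j /eqP vj]].
have := vertex_polar w0 (leqnn n); rewrite vj omegaX norm_expi mul1r => e.
have : expi (wind w n - 2 * pi * j%:R / 3) = 1 :> R[i].
  by rewrite expiD -e -expiD subrr expi0.
move=> /expi_eq1[m mE].
have wE : wind w n = 2 * pi * (j%:Z + m * 3)%:~R / 3 :> R.
  have -> : wind w n = 2 * pi * m%:~R + 2 * pi * j%:R / 3 :> R.
    by rewrite -mE subrK.
  by rewrite rmorphD rmorphM /=; field.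
by rewrite {1}wE (thirds_unique wE).
Qed.

(** Only the values of [thirds] on the finitely many walks of length n index a
    nonzero term, so the sum over all integers regroups the walks by winding
    angle. *)
Lemma EtildeE (s : R[i]) : Etilde s n = \sum_(w | returning w) s ^ thirds w.
Proof.
have coefE m :
    Etilde_coef R n m = #|[pred w | returning w && (thirds w == m)]|.
  apply: eq_card => w; rewrite !inE andbA -/(returning w).
  case rw : (returning w) => //=; have /andP[w0 _] := rw.
  rewrite winding_angleE//; apply/eqP/eqP => [/thirds_unique//|<-].
  exact: wind_thirds.
pose r := undup [seq thirds w | w <- enum (returning : pred (steps n))].
rewrite /Etilde (@fsbigE _ _ _ _ _ r) ?undup_uniq//; last first.
  move=> m _; rewrite mem_undup => mr; rewrite coefE eq_card0 ?mul0r// => w.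
  rewrite !inE; apply: contraNF mr => /andP[rw /eqP <-].
  by apply: map_f; rewrite mem_enum.
have tE (m : int) : (Etilde_coef R n m)%:R * s ^ m =
    \sum_(w | returning w) (if thirds w == m then s ^ m else 0) :> R[i].
  by rewrite coefE -big_mkcondr sumr_const mulr_natl; congr (_ *+ _).
rewrite (eq_bigr _ (fun m _ => tE m)) exchange_big /=; apply: eq_bigr => w rw.
have wr : thirds w \in r by rewrite mem_undup map_f// mem_enum.
rewrite [LHS](_ : _ =
  \sum_(m <- r | m \in setT) if thirds w == m then s ^ m else 0)//.
under eq_bigl do rewrite in_setT.
rewrite (bigD1_seq _ wr) ?undup_uniq//= eqxx big1_seq ?addr0// => m /andP[mw _].
by rewrite eq_sym (negbTE mw).
Qed.

End Counting.

(** * The reflection principle *)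

Section Bounce.
Context (R : realType) {n : nat}.
Variables (k1 k2 : int).
Hypotheses (hk1 : k1 < 0) (hk2 : 0 < k2).
Implicit Type w : steps n.

Definition inside w j : bool :=
  k1%:~R * pi / 3 < (wind w j : R) < k2%:~R * pi / 3.

Definition confined w := all (inside w) (iota 0 n.+1).

Lemma confinedP w : reflect (forall j, (j <= n)%N -> inside w j) (confined w).
Proof.
apply: (iffP allP) => h j.
  by rewrite -ltnS => jn; apply: h; rewrite mem_iota.
by rewrite mem_iota ltnS => /andP[_]; exact: h.
Qed.

(** The first vertex outside the interval; [n.+1] for a confined walk. *)
Definition exit_time w := find (predC (inside w)) (iota 0 n.+1).

Lemma exit_timeP w : ~~ confined w ->
  (exit_time w <= n)%N /\ ~~ inside w (exit_time w).
Proof.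
rewrite /confined -has_predC => h.
have := h; rewrite has_find size_iota ltnS => en; split=> //.
by have := nth_find 0%N h; rewrite nth_iota ?ltnS.
Qed.

Lemma inside_before_exit_time w j : (j < exit_time w)%N -> inside w j.
Proof.
move=> je; have jn : (j < n.+1)%N.
  by rewrite (leq_trans je)// -(size_iota 0 n.+1) find_size.
by have := before_find 0%N je; rewrite nth_iota//= => /negbFE.
Qed.

Lemma exit_time_unique w T : (T <= n)%N -> ~~ inside w T ->
  (forall j, (j < T)%N -> inside w j) -> exit_time w = T.
Proof.
move=> Tn wT before; have wn : ~~ confined w.
  by apply: contra wT => /confinedP; exact.
have [_ we] := exit_timeP wn.
have [/before eT|/inside_before_exit_time iT|//] := ltngtP (exit_time w) T.
- by rewrite eT in we.
- by rewrite iT in wT.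
Qed.

(** The index of the end of the interval through which the walk, if not
    confined, first leaves it. *)
Definition barrier w : int :=
  if (wind w (exit_time w) : R) <= k1%:~R * pi / 3 then k1 else k2.

Lemma inside0 w : inside w 0.
Proof.
have p0 := pi_gt0 R; rewrite /inside wind0; apply/andP; split.
- by rewrite pmulr_llt0 ?invr_gt0// pmulr_llt0// ltrz0.
- by rewrite divr_gt0// mulr_gt0// ltr0z.
Qed.

(** The walk is inside just before it leaves, and it cannot cross a barrier
    during one step: the first vertex outside is exactly on a barrier. *)
Lemma wind_exit_time w : avoids0 R w -> ~~ confined w ->
  wind w (exit_time w) = (barrier w)%:~R * pi / 3 :> R.
Proof.
move=> w0 /exit_timeP[en out]; have before := @inside_before_exit_time w.
rewrite /barrier; move: (exit_time w) en out before => [|T] Tn out before.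
  by rewrite inside0 in out.
have /andP[l1 l2] := before _ (ltnSn T).
have [_ c1] := @wind_no_crossing R n w k1 T w0 Tn.
have [c2 _] := @wind_no_crossing R n w k2 T w0 Tn.
rewrite l1 /= -leNgt in c1; rewrite l2 /= -leNgt in c2.
(* At exit, wind >= k1 pi / 3 and wind <= k2 pi / 3, with equality in one. *)
have [le|gt] := leP (wind w T.+1) (k1%:~R * pi / 3).
  exact: le_anti (introT andP (conj le c1)).
by apply: le_anti; rewrite c2 leNgt; move: out; rewrite /inside gt.
Qed.

Definition bouncing w := returning R w && ~~ confined w.

(** Reflects the part of the walk after its first contact with a barrier. The
    first contact suffices, although there are two barriers: the two reflections
    have the same effect on winding angles modulo k2 - k1, and only this class
    matters in the sums below. *)
Definition bounce w :=
  if bouncing w then reflect_after (exit_time w) (barrier w) w else w.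

Lemma bounce_spec w : bouncing w ->
  [/\ bouncing (bounce w), exit_time (bounce w) = exit_time w,
      barrier (bounce w) = barrier w &
      thirds R (bounce w) = barrier w - thirds R w].
Proof.
rewrite /bounce => bw; rewrite bw; set w' := reflect_after _ _ w.
have /andP[rw nc] := bw; have /andP[w0 _] := rw.
have [en out] := exit_timeP nc; have wE := wind_exit_time w0 nc.
have enn : (exit_time w <= n <= n)%N by rewrite en leqnn.
have w'j j : (j <= exit_time w)%N -> wind w' j = wind w j :> R.
  exact: wind_before.
have eE : exit_time w' = exit_time w.
  apply: exit_time_unique => //; first by rewrite /inside w'j.
  move=> j je; have := inside_before_exit_time je.
  by rewrite /inside w'j// ltnW.
have barrierE : barrier w' = barrier w by rewrite /barrier eE w'j.
have nc' : ~~ confined w'.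
  by apply: contra out => /confinedP/(_ _ en); rewrite /inside w'j.
have w'0 : avoids0 R w' by exact: avoids0_reflect.
have rw' : returning R w'.
  rewrite /returning w'0; have /andP[_ /existsP[j /eqP vj]] := rw.
  apply/existsP; exists (mirror_step (barrier w) j).
  by rewrite (vertex_after w0 en wE enn) vj mirror_omega.
split=> //; first by rewrite /bouncing rw'.
apply: thirds_unique; rewrite (wind_after w0 en wE enn) wind_thirds// rmorphB /=.
by field.
Qed.

Lemma bounceK : involutive bounce.
Proof.
move=> w; have [bw|nbw] := boolP (bouncing w); last first.
  by rewrite /bounce !(negbTE nbw).
have [bw' eE wE _] := bounce_spec bw.
by rewrite {1}/bounce bw' eE wE /bounce bw reflect_afterK.
Qed.

Lemma bouncing_bounce w : bouncing (bounce w) = bouncing w.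
Proof.
have [bw|nbw] := boolP (bouncing w); first by have [->] := bounce_spec bw.
by rewrite /bounce (negbTE nbw) (negbTE nbw).
Qed.

Variable k : int.
Hypotheses (hk1k : k1 < 2 * k) (hkk2 : 2 * k < k2).

(** The weight that the Fourier sum of the theorem gives to a walk of winding
    angle 2 pi m / 3. *)
Definition signed_class (m : int) : R[i] :=
  ((k2 - k1 %| m - k)%Z)%:R - ((k2 - k1 %| m - (k1 - k))%Z)%:R.

(** Reflection exchanges the classes of k and k1 - k, since k1 and k2 are
    congruent modulo k2 - k1. *)
Lemma signed_class_mirror c m : c = k1 \/ c = k2 ->
  signed_class (c - m) = - signed_class m.
Proof.
move=> hc; rewrite /signed_class [RHS]opprB.
congr (_%:R - _%:R); congr nat_of_bool.
- rewrite -[LHS]rpredN.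
  have [->|->] := hc; first by congr (_ %| _)%Z; ring.
  have -> : - (k2 - m - k) = (m - (k1 - k)) + (-1) * (k2 - k1) by ring.
  by rewrite rpredDr// dvdz_mull.
- rewrite -[LHS]rpredN.
  have [->|->] := hc; first by congr (_ %| _)%Z; ring.
  have -> : - (k2 - m - (k1 - k)) = (m - k) + (-1) * (k2 - k1) by ring.
  by rewrite rpredDr// dvdz_mull.
Qed.

(** Put N = k2 - k1. Both 2 m - k1 and 2 k - k1 lie strictly between 0 and N.
    Hence |m - k| < N, so that N divides m - k only for m = k, and
    m - (k1 - k), half their sum, lies strictly between 0 and N. *)
Lemma signed_class_inside m : k1 < 2 * m -> 2 * m < k2 ->
  signed_class m = (m == k)%:R.
Proof.
move=> m1 m2; rewrite /signed_class.
have -> : (k2 - k1 %| m - (k1 - k))%Z = false.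
  apply/negP => /dvdzP[q qE].
  have N0 : 0 < k2 - k1 by lia.
  have qa : 0 < q * (k2 - k1) by lia.
  have qb : q * (k2 - k1) < 1 * (k2 - k1) by lia.
  by rewrite pmulr_lgt0// in qa; rewrite ltr_pM2r// in qb; lia.
rewrite subr0; congr (_%:R); congr nat_of_bool.
apply/idP/eqP => [/dvdzP[q qE]|->].
  have N0 : 0 < k2 - k1 by lia.
  have qa : -1 * (k2 - k1) < q * (k2 - k1) by lia.
  have qb : q * (k2 - k1) < 1 * (k2 - k1) by lia.
  rewrite !ltr_pM2r// in qa qb.
  have q0 : q = 0 by lia.
  by move: qE; rewrite q0 mul0r => /eqP; rewrite subr_eq0 => /eqP.
by rewrite subrr dvdz0.
Qed.

(** The involution [bounce] changes the sign of the weight, so the sum is its own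
    opposite. *)
Lemma sum_bouncing : \sum_(w | bouncing w) signed_class (thirds R w) = 0.
Proof.
set S := \sum_(w | _) _.
have : S = - S.
  rewrite {1}/S (reindex_inj (inv_inj bounceK)) -sumrN.
  apply: eq_big => [w|w bw]; first exact: bouncing_bounce.
  rewrite bouncing_bounce in bw; have [_ _ _ ->] := bounce_spec bw.
  by apply: signed_class_mirror; rewrite /barrier; case: ifP; [left|right].
by move/eqP; rewrite -addr_eq0 -mulr2n mulrn_eq0 => /eqP.
Qed.

(** A confined walk with winding angle 2 pi k / 3 ending at a neighbour of 0 ends
    at omega ^ k: the other three neighbours of 0 have arguments that are odd
    multiples of pi / 3. *)
Lemma Etilde_confinedE : Etilde_confined R k k1 k2 n =
  \sum_(w | returning R w && confined w) (thirds R w == k)%:R.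
Proof.
rewrite /Etilde_confined (eq_card (B :=
  [pred w | (returning R w && confined w) && (thirds R w == k)])).
  rewrite -sum1_card natr_sum big_mkcondr /=; apply: eq_bigr => w _.
  by case: eqP.
move=> w; rewrite !inE /returning; case w0 : (avoids0 R w) => //=.
rewrite winding_angleE//.
have conf : `[< forall x : R, 0 <= x <= n%:R ->
    k1%:~R * pi / 3 < winding w x < k2%:~R * pi / 3 >] = confined w.
  by apply/asboolP/confinedP => /(winding_confinedP w0).
rewrite conf; apply/and3P/andP.
  move=> [adj /eqP we cw].
  have wE := vertex_polar w0 (leqnn n).
  have vn : vertex R w n = omega R ^+ `|(k %% 3)%Z|%N.
    have k3 : (0 <= k %% 3)%Z by exact: modz_ge0.
    rewrite wE we omega_rot gez0_abs// rot_mod /rot_third.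
    suff -> : `|vertex R w n| = 1 by rewrite mul1r.
    move: adj => /existsP[j]; rewrite sub0r [0 == _]eq_sym subr_eq0.
    by move=> /orP[] /eqP ->; rewrite ?normrN omegaX norm_expi.
  split; last by rewrite (thirds_unique we).
  rewrite cw andbT; apply/existsP.
  have k3 : (`|(k %% 3)%Z| < 3)%N.
    by have := @ltz_pmod k 3 isT; have := @modz_ge0 k 3 isT; lia.
  by exists (Ordinal k3); rewrite /= vn.
move=> [/andP[ex cw] /eqP tk]; have /existsP[j /eqP vj] := ex.
have rw : returning R w by rewrite /returning w0.
split=> //; last by rewrite (wind_thirds rw) tk.
by apply/existsP; exists j; rewrite vj subrr eqxx orbT.
Qed.

Lemma sum_returning :
  \sum_(w : steps n | returning R w) signed_class (thirds R w) =
  Etilde_confined R k k1 k2 n.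
Proof.
rewrite (bigID confined) /= -/bouncing sum_bouncing addr0 Etilde_confinedE.
apply: eq_bigr => w /andP[rw /confinedP/(_ _ (leqnn n))].
rewrite /inside wind_thirds// => /andP[l1 l2].
have p0 := pi_gt0 R.
have tE : 2 * pi * (thirds R w)%:~R / 3 = (2 * thirds R w)%:~R * pi / 3 :> R.
  by rewrite rmorphM /=; field.
rewrite tE !ltr_pM2r ?invr_gt0// !ltr_int in l1 l2.
exact: signed_class_inside.
Qed.

End Bounce.

Unset Implicit Arguments.

Theorem mainTheorem6 (R : realType) (k k1 k2 : int)
    (hk1 : k1 < 0) (hk2 : 0 < k2) (hk1k : k1 < 2 * k) (hkk2 : 2 * k < k2) :
  Etilde_confined R k k1 k2 =
  ((k2 - k1)%:~R^-1 : R[i]) *: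
    \sum_(1 <= j < absz (k2 - k1))
      (expi (- (2 * pi * j%:R * k%:~R / (k2 - k1)%:~R))
         - expi (2 * pi * j%:R * (k - k1)%:~R / (k2 - k1)%:~R)) *:
      Etilde (expi (2 * pi * j%:R / (k2 - k1)%:~R)).
Proof.
apply/funext => n.
rewrite -(@sum_returning R n k1 k2 hk1 hk2 k hk1k hkk2) /signed_class.
have : 0 < k2 - k1 by lia.
move NE : (k2 - k1) => [N|//] N0; rewrite ltz_nat in N0.
have Nn0 : N%:R != 0 :> R[i] by rewrite pnatr_eq0 -lt0n.
have NR0 : N%:R != 0 :> R by rewrite pnatr_eq0 -lt0n.
rewrite -[RHS]/(N%:R^-1 * (_ : nat -> R[i]) n) fct_sumE.
apply: (mulfI Nn0); rewrite mulVKf//.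
pose E (j : nat) (w : steps n) : R[i] :=
  expi (2 * pi * j%:R * (thirds R w - k)%:~R / N%:R)
  - expi (2 * pi * j%:R * (thirds R w - (k1 - k))%:~R / N%:R).
transitivity (\sum_(w : steps n | returning R w) \sum_(0 <= j < N) E j w).
  rewrite mulr_sumr; apply: eq_bigr => w _.
  by rewrite big_mkord sumrB !sum_roots_of_unity// mulrBr !mulr_natl.
(* The term j = 0 of the full Fourier sum vanishes, since both exponentials
   are then 1. *)
rewrite exchange_big /= big_ltn// big1 ?add0r => [|w _]; last first.
  by rewrite /E !mulr0 !mul0r subrr.
apply: eq_bigr => j _.
rewrite -[RHS]/(_ * Etilde _ n) EtildeE mulr_sumr; apply: eq_bigr => w _.
rewrite expiXz mulrBl -!expiD; congr (expi _ - expi _).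
- by rewrite rmorphB /=; field.
- by rewrite !rmorphB /=; field.
Qed.
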